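(* Let $m\ge 2$, $k\ge 1$, $n\ge 1$ be integers. Let $\mathcal{A}$ be a real tensor of order $m$ and dimension $n$ and let $\mathcal{B}$ be a real tensor of order $k$ and dimension $n$. If $\mathcal{A}$ and $\mathcal{B}$ are both centrosymmetric, then the product $\mathcal{A}\mathcal{B}$ is a centrosymmetric tensor of order $(m-1)(k-1)+1$ and dimension $n$.
   Context: Write $[n]=\{1,\dots,n\}$. A real tensor of order $m$ and dimension $n$ is an array $\mathcal{A}=(a_{i_1\cdots i_m})$ of real numbers with $i_1,\dots,i_m\in[n]$. It is centrosymmetric if $a_{i_1 i_2\cdots i_m}=a_{n-i_1+1,\,n-i_2+1,\,\dots,\,n-i_m+1}$ for all $i_1,\dots,i_m\in[n]$. Tensor product: for $\mathcal{A}$ of order $m\ge2$ and $\mathcal{B}$ of order $k\ge1$, both of dimension $n$, $\mathcal{A}\mathcal{B}$ is the tensor of order $(m-1)(k-1)+1$ and dimension $n$ with entries $$(\mathcal{A}\mathcal{B})_{i\alpha_1\cdots\alpha_{m-1}}=\sum_{i_2,\dots,i_m\in[n]}a_{i i_2\cdots i_m}\,b_{i_2\alpha_1}\cdots b_{i_m\alpha_{m-1}},$$ where $i\in[n]$ and $\alpha_1,\dots,\alpha_{m-1}\in[n]^{k-1}$ are multi-indices. *)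

(* Defs.v *)
From mathcomp Require Import all_boot all_order all_algebra.
From mathcomp Require Import reals.

Set Implicit Arguments.
Unset Strict Implicit.
Unset Printing Implicit Defensive.

Import GRing.Theory.
Local Open Scope ring_scope.

(* Positions and index values are 0-based: [n] is represented by 'I_n. *)
Definition multi_index (m n : nat) := {ffun 'I_m -> 'I_n}.

Definition tensor (R : Type) (m n : nat) := {ffun multi_index m n -> R}.

(* In 0-based terms i |-> n - i + 1 is i |-> n - 1 - i, that is, rev_ord. *)
Definition rev_index (m n : nat) (I : multi_index m n) : multi_index m n :=
  [ffun p => rev_ord (I p)].

Definition centrosymmetric (R : Type) (m n : nat) (A : tensor R m n) : Prop :=
  forall I : multi_index m n, A I = A (rev_index I).

Lemma ord_gt0 (m : nat) (p : 'I_m) : (0 < m)%N.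
Proof. exact: leq_ltn_trans (leq0n p) (ltn_ord p). Qed.

(* The multi-index (i, v_1, ..., v_(m-1)) of length m: position 0 holds i and
   position p > 0 holds the value of v at p - 1. *)
Definition cons_index (m n : nat) (i : 'I_n) (v : multi_index m.-1 n) :
    multi_index m n :=
  [ffun p : 'I_m => oapp v i (unlift (Ordinal (ord_gt0 p)) p)].

Lemma block_pos_subproof (r l : nat) (s : 'I_r) (t : 'I_l) :
  (s * l + t < r * l)%N.
Proof.
apply: (@leq_trans (s.+1 * l)); first by rewrite mulSn addnC ltn_add2r.
by rewrite leq_mul2r ltn_ord orbT.
Qed.

Definition block_pos (r l : nat) (s : 'I_r) (t : 'I_l) : 'I_(r * l) :=
  Ordinal (block_pos_subproof s t).

(* An index J of length r * l + 1 is read as (i, alpha_1, ..., alpha_r), where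
   i = J ord0 and each alpha_s has length l; alpha_s is index_block J s. *)
Definition index_block (r l n : nat) (J : multi_index (r * l).+1 n)
    (s : 'I_r) : multi_index l n :=
  [ffun t => J (lift ord0 (block_pos s t))].

(* Meaningful for m >= 2 and k >= 1; v ranges over (i_2, ..., i_m). *)
Definition tensor_prod (R : comPzRingType) (m k n : nat)
    (A : tensor R m n) (B : tensor R k n) :
    tensor R (m.-1 * k.-1).+1 n :=
  [ffun J : multi_index (m.-1 * k.-1).+1 n =>
    \sum_(v : multi_index m.-1 n)
      A (cons_index (J ord0) v) *
      \prod_(s < m.-1) B (cons_index (v s) (index_block J s))].

(* Main.v *)
Require Import Defs.
From mathcomp Require Import all_boot all_order all_algebra.
From mathcomp Require Import reals.

(** Reversal is an involution on the summation indices [v], so the sum for [rev_index J] may be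
    taken over [rev_index v]. It then agrees term by term with the sum for [J], by the symmetry of
    [A] and of each factor [B]. *)

Lemma rev_indexK (m n : nat) : involutive (@rev_index m n).
Proof. by move=> I; apply/ffunP=> p; rewrite !ffunE rev_ordK. Qed.

(** [rev_index] reflects values and leaves positions in place, so the head stays the head; blocks
    survive for the same reason. *)
Lemma rev_cons_index (m n : nat) (i : 'I_n) (v : multi_index m.-1 n) :
  rev_index (cons_index i v) = cons_index (rev_ord i) (rev_index v).
Proof.
by apply/ffunP=> p; rewrite !ffunE; case: unliftP => [q _|_] //=; rewrite ffunE.
Qed.

Lemma index_block_rev (r l n : nat) (J : multi_index (r * l).+1 n) (s : 'I_r) :
  index_block (rev_index J) s = rev_index (index_block J s).
Proof. by apply/ffunP=> t; rewrite !ffunE. Qed.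

Theorem theorem3p1 (R : realType) (m k n : nat)
    (hm : (2 <= m)%N) (hk : (1 <= k)%N) (hn : (1 <= n)%N)
    (A : tensor R m n) (B : tensor R k n) :
  centrosymmetric A -> centrosymmetric B ->
  centrosymmetric (tensor_prod A B : tensor R (m.-1 * k.-1).+1 n).
Proof.
(* Only the right-hand sum is reindexed; symmetry is then applied to the left-hand factors. *)
move=> symA symB J; rewrite !ffunE [RHS](reindex_inj (inv_inj (@rev_indexK _ _))).
apply: eq_bigr => v _; rewrite symA rev_cons_index; congr (_ * _)%R.
apply: eq_bigr => s _.
by rewrite symB rev_cons_index index_block_rev [rev_index v s]ffunE.
Qed.
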